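(* (a) For all integers $n$ and $m$ with $1\le m<\frac{2n}{9}$, \[ T_L(n,m)\ge 3^{\left\lfloor\frac{n-18m+93}{43}\right\rfloor}. \] (b) Moreover, if $m=m(n)\ge 1$ is an integer-valued function of $n$ with $m=o(n)$, then for all sufficiently large $n$, \[ T_L(n,m)\ge 3^{\left\lfloor\frac{n-5m+21}{10}\right\rfloor}. \]
   Context: Identify $\{0,1,2\}$ with the field $\mathbb{F}_3$. Three words $x,y,z\in\mathbb{F}_3^n$ triffer at position $i$ if $\{x_i,y_i,z_i\}=\{0,1,2\}$, i.e. $x_i,y_i,z_i$ are pairwise distinct. For integers $n\ge m\ge1$, a code $C\subseteq\mathbb{F}_3^n$ is $m$-trifferent if any three distinct codewords of $C$ triffer in at least $m$ positions. A linear code is a linear subspace of $\mathbb{F}_3^n$. $T_L(n,m)$ denotes the largest size (number of codewords) of a linear $m$-trifferent code in $\mathbb{F}_3^n$. *)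

(* Defs.v *)
From mathcomp Require Import all_boot all_order all_algebra.

Set Implicit Arguments.
Unset Strict Implicit.
Unset Printing Implicit Defensive.

Import GRing.Theory.

Local Open Scope ring_scope.

Section Trifferent.
Variable n : nat.
Implicit Types (x y z : 'rV['F_3]_n) (C : {set 'rV['F_3]_n}).

Definition triffer x y z (i : 'I_n) : bool :=
  [set x 0 i; y 0 i; z 0 i] == [set: 'F_3].

Definition trifferent (m : nat) C : bool :=
  [forall x in C, forall y in C, forall z in C,
     uniq [:: x; y; z] ==> (m <= #|[set i | triffer x y z i]|)%N].

Definition linear_code C : bool :=
  (0 \in C) && [forall a : 'F_3, forall x in C, forall y in C, a *: x + y \in C].

Lemma trifferP x y z i :
  triffer x y z i = uniq [:: x 0 i; y 0 i; z 0 i].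
Proof.
rewrite /triffer eqEcard subsetT cardsT card_Fp //.
have -> : [set x 0 i; y 0 i; z 0 i] = [set t in [:: x 0 i; y 0 i; z 0 i]].
  by apply/setP => t; rewrite !inE orbA.
rewrite cardsE; apply/idP/idP => [h|/card_uniqP e]; last by rewrite e.
by apply/card_uniqP/eqP; rewrite eqn_leq card_size.
Qed.

Lemma linear_codeP C : reflect (submod_closed C) (linear_code C).
Proof.
apply: (iffP andP) => [[C0 /forallP lC]|[C0 lC]]; split=> //.
  by move=> a x y xC yC; have /forall_inP/(_ x xC)/forall_inP/(_ y yC) := lC a.
apply/forallP => a; apply/forall_inP => x xC; apply/forall_inP => y yC.
exact: lC.
Qed.

End Trifferent.

(* The zero code is linear and vacuously trifferent, so this maximum is never
   taken over the empty family. *)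
Definition T_L (n m : nat) : nat :=
  \max_(C : {set 'rV['F_3]_n} | linear_code C && trifferent m C) #|C|.

(* Main.v *)
(* Let the columns g_1, ..., g_n of a generator matrix over F_3 be chosen
   uniformly at random. By linearity three codewords may be replaced by 0, x g
   and y g with x, y, 0 distinct, and such a triple triffers at a given position
   with probability at least 2/9. An exponential Markov bound with parameter
   1/b for the number of these positions, summed over the at most 9^k pairs
   (x, y), yields a code of dimension k as soon as
   9^k b^m ((7 b + 2) / (9 b))^n < 1. With b = 10 this is enough for (b), and
   for (a) in dimension at least 3; in dimension at most 2 the hypothesis
   m < 2n/9 leaves room for m copies of each of the four points of the
   projective line over F_3. *)
Require Import Defs.
From mathcomp Require Import all_boot all_order all_algebra.
From mathcomp Require Import zify lra.
Import Order.TTheory GRing.Theory Num.Theory.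
Local Open Scope ring_scope.

(** * Columns that separate a pair of vectors *)

Definition separates {k : nat} (x y : 'rV['F_3]_k) (g : 'cV['F_3]_k) : bool :=
  uniq [:: 0; (x *m g) 0 0; (y *m g) 0 0].

Lemma F3_cases (c : 'F_3) : [\/ c = 0, c = 1 | c = -1].
Proof.
by case: c => [[|[|[|c]]]] // lt_c3; [apply: Or31|apply: Or32|apply: Or33]; apply/val_inj.
Qed.

Lemma card_cV3 (k : nat) : #|{: 'cV['F_3]_k}| = (3 ^ k)%N.
Proof. by rewrite card_mx card_Fp // muln1. Qed.

Lemma card_rV3 (k : nat) : #|{: 'rV['F_3]_k}| = (3 ^ k)%N.
Proof. by rewrite card_mx card_Fp // mul1n. Qed.

(** Over F_3, [x] is not a multiple of [x + y], so some column annihilates [x + y] but not [x];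
    rescaling it gives the values 1 and -1. *)
Lemma separating_column {k : nat} {x y : 'rV['F_3]_k} :
  x != 0 -> y != 0 -> x != y ->
  exists g : 'cV_k, (x *m g) 0 0 = 1 /\ (y *m g) 0 0 = -1.
Proof.
move=> x0 y0 xy.
have : ~~ (x <= (x + y)%R)%MS.
  apply/negP => /sub_rVP[c]; case: (F3_cases c) => ->.
  - by rewrite scale0r => e; rewrite e eqxx in x0.
  - rewrite scale1r -{1}[x]addr0 => /addrI e.
    by rewrite -e eqxx in y0.
  - rewrite scaleN1r => e; case/eqP: xy.
    apply/rowP => i; move: (congr1 (fun v : 'rV_k => v 0 i) e); rewrite !mxE.
    by case: (F3_cases (x 0 i)) => ->; case: (F3_cases (y 0 i)) => -> // /eqP.
rewrite submxE => /rV0Pn[j].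
set g := col j (cokermx (x + y)).
have gE z : (z *m g) 0 0 = (z *m cokermx (x + y)) 0 j by rewrite /g colE mulmxA -colE mxE.
rewrite -gE => xg0.
have : ((x + y) *m g) 0 0 = 0 by rewrite gE mulmx_coker mxE.
rewrite mulmxDl mxE => /eqP; rewrite addrC addr_eq0 => /eqP yg.
exists (((x *m g) 0 0)^-1 *: g).
have gZ z : (z *m (((x *m g) 0 0)^-1 *: g)) 0 0 = ((x *m g) 0 0)^-1 * (z *m g) 0 0.
  by rewrite -scalemxAr mxE.
by rewrite !gZ yg mulrN mulVf.
Qed.

Lemma card_separates {k : nat} {x y : 'rV['F_3]_k} :
  x != 0 -> y != 0 -> x != y ->
  (2 * 3 ^ k <= 9 * #|[set g | separates x y g]|)%N.
Proof.
move=> x0 y0 xy; have [g [xg yg]] := separating_column x0 y0 xy.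
(* The nonempty fibres of phi are cosets of ker and there are at most 9 of
   them; the two over (1, -1) and (-1, 1) consist of separating columns. *)
pose phi (h : 'cV_k) := ((x *m h) 0 0, (y *m h) 0 0).
pose ker := [set h | phi h == 0].
have fiber_le p : (#|[set h | phi h == p]| <= #|ker|)%N.
  have [->|/set0Pn[h0]] := eqVneq [set h | phi h == p] set0; first by rewrite cards0.
  rewrite inE => /eqP <-.
  rewrite -(card_imset _ (addIr (- h0))); apply/subset_leq_card/subsetP => _ /imsetP[h + ->].
  by rewrite !inE /phi !mulmxBr !mxE => /eqP[-> ->]; rewrite !subrr.
have ker_le : (3 ^ k <= 9 * #|ker|)%N.
  rewrite -card_cV3 -[leqLHS]sum1_card (partition_big phi predT) //=.
  have -> : 9%N = #|{: 'F_3 * 'F_3}| by rewrite card_prod card_Fp.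
  rewrite -sum_nat_const; apply: leq_sum => p _.
  rewrite sum1_card; apply: leq_trans (fiber_le p).
  by apply: eq_leq; apply: eq_card => h; rewrite inE.
suff: (2 * #|ker| <= #|[set h | separates x y h]|)%N by lia.
have addE z v h : (z *m (v + h)) 0 0 = (z *m v) 0 0 + (z *m h) 0 0 :> 'F_3.
  by rewrite mulmxDr [LHS]mxE.
have oppE z : (z *m (- g)) 0 0 = - (z *m g) 0 0 :> 'F_3 by rewrite mulmxN [LHS]mxE.
pose A := [set g + h | h in ker]; pose B := [set - g + h | h in ker].
have disAB : [disjoint A & B].
  rewrite disjoints_subset; apply/subsetP => _ /imsetP[h + ->].
  rewrite !inE => /eqP[xh _]; apply/negP => /imsetP[h' + e].
  rewrite inE => /eqP[xh' _].
  have := congr1 (fun v => (x *m v) 0 0) e.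
  by rewrite /= !addE oppE xh xh' xg.
have -> : (2 * #|ker| = #|A :|: B|)%N.
  rewrite cardsU disjoint_setI0 // cards0 subn0.
  by rewrite !card_imset ?mul2n ?addnn //; exact: addrI.
apply/subset_leq_card/subsetP => v; rewrite inE => /orP[] /imsetP[h + ->];
  rewrite !inE => /eqP[xh yh];
  by rewrite /separates !addE ?oppE xh yh xg yg.
Qed.

(** * From families of columns to linear codes *)

Lemma T_L_ge_columns {n m k : nat} (f : 'I_n -> 'cV['F_3]_k) :
  (0 < m)%N ->
  (forall x y : 'rV_k, x != 0 -> y != 0 -> x != y ->
     (m <= #|[set i | separates x y (f i)]|)%N) ->
  (3 ^ k <= T_L n m)%N.
Proof.
move=> m0 sep.
pose G : 'M['F_3]_(k, n) := \matrix_(r, i) f i r 0.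
have GE x i : (x *m G) 0 i = (x *m f i) 0 0.
  by rewrite !mxE; apply: eq_bigr => r _; rewrite !mxE.
(* A nonzero v with v G = 0 would form with -v an admissible pair that no column separates, against
   [0 < m]. *)
have injG : injective (fun x : 'rV_k => x *m G).
  move=> x y /= exy; apply/eqP; rewrite -subr_eq0; apply/negP => /negP xy0.
  have zG : (x - y) *m G = 0 by rewrite mulmxBl exy subrr.
  have Nxy : x - y != - (x - y).
    apply/negP => /eqP e; case/rV0Pn: xy0 => i; apply/negP; rewrite negbK.
    move: (congr1 (fun v : 'rV_k => v 0 i) e); rewrite [RHS]mxE.
    by case: (F3_cases ((x - y) 0 i)) => ->.
  have Nxy0 : - (x - y) != 0 by rewrite oppr_eq0.
  have := leq_trans m0 (sep _ _ xy0 Nxy0 Nxy).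
  rewrite card_gt0 => /set0Pn[i]; rewrite inE /separates -GE zG mxE.
  by rewrite cons_uniq mem_head.
pose C := [set x *m G | x : 'rV_k].
rewrite -card_rV3 -(card_imset _ injG) -[[set _ | _ in _]]/C.
apply: (@leq_bigmax_cond _ _ (fun C : {set 'rV_n} => #|C|)); apply/andP; split.
  apply/linear_codeP; split; first by apply/imsetP; exists 0; rewrite ?mul0mx.
  move=> a _ _ /imsetP[x _ ->] /imsetP[y _ ->]; apply/imsetP; exists (a *: x + y) => //.
  by rewrite mulmxDl scalemxAl.
apply/forall_inP => _ /imsetP[x _ ->]; apply/forall_inP => _ /imsetP[y _ ->].
apply/forall_inP => _ /imsetP[z _ ->]; apply/implyP.
rewrite (map_inj_uniq injG [:: x; y; z]) => /=.
rewrite !inE negb_or => /and3P[/andP[xy xz] yz _].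
have yx0 : y - x != 0 by rewrite subr_eq0 eq_sym.
have zx0 : z - x != 0 by rewrite subr_eq0 eq_sym.
have yzx : y - x != z - x by rewrite (inj_eq (addIr _)).
apply: leq_trans (sep _ _ yx0 zx0 yzx) _.
apply/subset_leq_card/subsetP => i; rewrite !inE trifferP /separates -!GE.
have subE v : ((v - x) *m G) 0 i = (v *m G) 0 i - (x *m G) 0 i.
  by rewrite mulmxBl [LHS]mxE [X in _ + X = _]mxE.
by rewrite !subE -(map_inj_uniq (addIr (- (x *m G) 0 i)) [:: (x *m G) 0 i; _; _]) /= subrr.
Qed.

Lemma T_L_gt0 {n m : nat} : (0 < m)%N -> (0 < T_L n m)%N.
Proof.
move=> m0; apply: (T_L_ge_columns (k := 0) (fun=> 0)) => // x.
by rewrite thinmx0 eqxx.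
Qed.

Lemma T_L_ge9 {n m : nat} : (0 < m)%N -> (4 * m <= n)%N -> (9 <= T_L n m)%N.
Proof.
move=> m0 le4mn.
(* dir 0, ..., dir 3 represent the points (1, 0), (1, 1), (1, 2), (0, 1) of the
   projective line, so the separating g is a multiple of one of them. *)
pose dir (j : nat) : 'cV['F_3]_2 :=
  \col_r (if r == 0 then (j < 3)%:R else if (j < 3)%N then j%:R else 1).
apply: (T_L_ge_columns (k := 2) (fun i => dir (i %% 4)%N)) => // x y x0 y0 xy.
have [g [xg yg]] := separating_column x0 y0 xy.
have [j ltj4 [c gE]] : exists2 j : nat, (j < 4)%N & exists c, g = c *: dir j.
  have [g0|g0] := eqVneq (g 0 0) 0.
    exists 3%N => //; exists (g 1 0); apply/colP => r; rewrite !mxE.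
    case: (unliftP 0 r) => [s|] ->; rewrite ?g0 ?mulr0 // ord1 mulr1.
    by congr (g _ _); apply/val_inj.
  (* A point off the line at first coordinate 0 is represented by its slope. *)
  pose j := nat_of_ord (g 1 0 / g 0 0).
  have ltj3 : (j < 3)%N := ltn_ord _.
  exists j; first exact: ltnW.
  exists (g 0 0); apply/colP => r; rewrite !mxE ltj3.
  case: (unliftP 0 r) => [s|] ->; rewrite ?mulr1 // ord1.
  rewrite /= natr_Zp mulrC divfK //; congr (g _ _); exact/val_inj.
(* Here [c] is nonzero because x g = 1, and nonzero scaling preserves separation. *)
have sepj : separates x y (dir j).
  have scaleE z : (z *m (c *: dir j)) 0 0 = c * (z *m dir j) 0 0.
    by rewrite -scalemxAr [LHS]mxE.
  move: xg yg; rewrite gE !scaleE /separates.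
  case: (F3_cases c) => ->; rewrite ?mul0r ?mul1r ?mulN1r.
  - by move/eqP.
  - by move=> -> ->.
  - by move=> /(canRL (@opprK _)) -> /(canRL (@opprK _)) ->.
(* The columns cycle through the four directions, so the [m] positions 4t + j all carry [dir j]. *)
have pos_lt (t : 'I_m) : (4 * t + j < n)%N by have := ltn_ord t; lia.
have injpos : injective (fun t => Ordinal (pos_lt t)).
  by move=> t t' [] e; apply/val_inj => /=; lia.
rewrite -[m in (m <= _)%N]card_ord -(card_imset _ injpos).
apply/subset_leq_card/subsetP => _ /imsetP[t _ ->]; rewrite inE /=.
by rewrite mulnC modnMDl modn_small.
Qed.

(** * The union bound over random columns *)

Lemma T_L_ge_union {n m k} b :
  (0 < m)%N -> (0 < b)%N ->
  (9 ^ k * b ^ m * (7 * b + 2) ^ n < (9 * b) ^ n)%N -> (3 ^ k <= T_L n m)%N.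
Proof.
move=> m0 b0 small.
pose pairs := [pred p : 'rV['F_3]_k * 'rV['F_3]_k | [&& p.1 != 0, p.2 != 0 & p.1 != p.2]].
pose hits (p : 'rV['F_3]_k * 'rV['F_3]_k) (f : {ffun 'I_n -> 'cV['F_3]_k}) :=
  #|[set i | separates p.1 p.2 (f i)]|.
case: (pickP (fun f => [forall p in pairs, (m <= hits p f)%N])) => [f /forall_inP good|allbad].
  apply: (T_L_ge_columns f) => // x y x0 y0 xy.
  by have := good (x, y); apply; rewrite inE /= x0 y0.
(* b ^ n times the indicator of [hits p f < m] is at most
   b ^ m * \prod_i w p (f i), and the sum over f of this product factors. *)
pose w (p : 'rV['F_3]_k * 'rV['F_3]_k) (g : 'cV['F_3]_k) :=
  (if separates p.1 p.2 g then 1 else b)%N.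
have w_sum p : pairs p -> (9 * \sum_g w p g <= (7 * b + 2) * 3 ^ k)%N.
  case/and3P => p1 p2 p12; have := card_separates p1 p2 p12.
  rewrite -card_cV3; set S := [set g | _].
  have -> : (\sum_g w p g = \sum_(g in S) 1 + \sum_(g in ~: S) b)%N.
    rewrite (bigID [in S]) /=; congr (_ + _)%N; apply: eq_big => g; rewrite ?inE // /w.
      by move=> ->.
    by move=> /negbTE ->.
  (* The right side minus the left is (b - 1)(7 |S| - 2 |~: S|), which is nonnegative by the bound
     on |S|. *)
  by rewrite !sum_nat_const -(cardsC S); nia.
have w_prod p (f : {ffun _}) : (b ^ n = (\prod_i w p (f i)) * b ^ hits p f)%N.
  have -> : (b ^ hits p f = \prod_i (if separates p.1 p.2 (f i) then b else 1))%N.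
    rewrite -big_mkcond /= -prod_nat_const.
    by apply: eq_bigl => i; rewrite inE.
  rewrite -big_split /= -{1}[n]card_ord -prod_nat_const; apply: eq_bigr => i _.
  by rewrite /w; case: ifP => _; rewrite ?mul1n ?muln1.
(* Each [f] fails at some pair, whose term in the inner sum alone is at least [b ^ n]. *)
have bound1 : ((3 ^ k) ^ n * b ^ n <=
    \sum_(f : {ffun 'I_n -> 'cV['F_3]_k}) \sum_(p | pairs p) b ^ m * \prod_i w p (f i))%N.
  rewrite -card_cV3 -{1}[n]card_ord -card_ffun -sum_nat_const; apply: leq_sum => f _.
  have /negbT/forall_inPn[p pp] := allbad f; rewrite -ltnNge => lt_m.
  rewrite (bigD1 p) //= (w_prod p f) mulnC; apply: leq_trans (leq_addr _ _).
  by rewrite leq_pmul2r ?leq_pexp2l ?(ltnW lt_m) //; apply: prodn_gt0 => i; rewrite /w; case: ifP.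
rewrite exchange_big /= in bound1.
have bound2 : (9 ^ n * ((3 ^ k) ^ n * b ^ n) <= \sum_(p | pairs p) b ^ m * ((7 * b + 2) * 3 ^ k) ^ n)%N.
  apply: leq_trans (leq_mul (leqnn _) bound1) _.
  rewrite big_distrr /=; apply: leq_sum => p pp.
  rewrite -big_distrr /= mulnCA leq_mul2l; apply/orP; right.
  rewrite -(bigA_distr_bigA (fun=> w p)) prod_nat_const card_ord -expnMn.
  by case: (posnP n) => [->//|n0]; rewrite leq_exp2r // w_sum.
have bound3 : (9 ^ n * ((3 ^ k) ^ n * b ^ n) <= 9 ^ k * (b ^ m * ((7 * b + 2) * 3 ^ k) ^ n))%N.
  apply: leq_trans bound2 _; rewrite sum_nat_const leq_mul2r; apply/orP; right.
  apply: leq_trans (max_card _) _.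
  by rewrite card_prod card_rV3 -expnMn.
move: small; rewrite ltnNge => /negP[].
have q0 : (0 < (3 ^ k) ^ n)%N by rewrite !expn_gt0.
rewrite -(leq_pmul2r q0) expnMn; move: bound3; rewrite expnMn; lia.
Qed.

(* Imported only here because its set notations shadow those of finset. *)
From mathcomp Require Import all_classical all_reals all_analysis.
Import Order.TTheory GRing.Theory Num.Theory.
Import numFieldNormedType.Exports.
Local Open Scope classical_set_scope.
Local Open Scope ring_scope.

(** * Logarithmic form and numerical constants *)

Lemma T_L_ge_log (R : realType) (n m k : nat) :
  (0 < m)%N ->
  k%:R * ln 9 + m%:R * ln 10 < n%:R * (ln 5 - ln 4) :> R ->
  (3 ^ k <= T_L n m)%N.
Proof.
move=> m0 small; apply: (@T_L_ge_union _ _ _ 10); [exact: m0 | exact: ltn0Sn |].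
(* Cancelling [18 ^ n] leaves the ratio 4/5 per position. *)
have -> : (7 * 10 + 2 = 18 * 4)%N by [].
have -> : (9 * 10 = 18 * 5)%N by [].
rewrite !(expnMn _ _ n) mulnCA ltn_pmul2l ?expn_gt0 //.
rewrite -(ltr_nat R) -ltr_ln ?posrE ?ltr0n ?muln_gt0 ?expn_gt0 //.
rewrite !natrM !natrX !lnM ?posrE ?mulr_gt0 ?exprn_gt0 ?ltr0n // !lnXn ?ltr0n //.
by rewrite -!(mulr_natl (ln _)); lra.
Qed.

Lemma ltr_ln_mulX (R : realType) (a b c : R) (p : nat) :
  0 < a -> 0 < b -> 0 < c -> a * b ^+ p < c ^+ p ->
  ln a < p%:R * (ln c - ln b).
Proof.
move=> a0 b0 c0; rewrite -ltr_ln ?posrE ?mulr_gt0 ?exprn_gt0 //.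
by rewrite lnM ?posrE ?exprn_gt0 // !lnXn // mulrBr !mulr_natl ltrBrDr.
Qed.

(** Amounts to 9 * 4^10 < 5^10; this gap is the slack [c] that later absorbs the o(n) term. *)
Lemma ln9_lt (R : realType) : ln 9 < 10 * (ln 5 - ln 4) :> R.
Proof. apply: ltr_ln_mulX; lra. Qed.

Lemma ln10_lt (R : realType) : ln 10 < 18 * (ln 5 - ln 4) :> R.
Proof. apply: ltr_ln_mulX; lra. Qed.

(** Reduces to natural exponents: a negative power of [a] is at most 1, hence at most [N]. *)
Lemma expz_floor_le (R : realType) (r : R) (a N : nat) :
  (0 < a)%N -> (0 < N)%N -> (forall k : nat, k%:R <= r -> (a ^ k <= N)%N) ->
  a%:R ^ Num.floor r <= N%:R :> R.
Proof.
move=> a0 N0 le_N; have := floor_le r.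
case: (Num.floor r) => k kr.
  by rewrite -exprnP -natrX ler_nat le_N.
rewrite NegzE -exprnN; apply: (@le_trans _ _ 1); last by rewrite ler1n.
by rewrite invf_le1 ?exprn_gt0 ?ltr0n // exprn_ege1 // ler1n.
Qed.

Theorem corollary4p8 (R : realType) :
  (forall n m : nat,
     (1 <= m)%N -> m%:R < 2 * n%:R / 9 :> R ->
     3 ^ Num.floor ((n%:R - 18 * m%:R + 93) / 43 : R) <= (T_L n m)%:R :> R)
  /\
  (forall m : nat -> nat,
     (forall n : nat, (1 <= n)%N -> (1 <= m n)%N) ->
     (fun n : nat => (m n)%:R : R) =o_\oo (fun n : nat => n%:R : R) ->
     \forall n \near \oo,
       3 ^ Num.floor ((n%:R - 5 * (m n)%:R + 21) / 10 : R)
         <= (T_L n (m n))%:R :> R).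
Proof.
have ln9 := ln9_lt R; have ln10 := ln10_lt R.
have l9 : 0 < ln 9 :> R by rewrite ln_gt0 // ltr1n.
have l10 : 0 < ln 10 :> R by rewrite ln_gt0 // ltr1n.
set L : R := ln 5 - ln 4 in ln9 ln10.
split=> [n m m0 mn|m m0 /eqoP mo].
  apply: (@expz_floor_le _ _ 3) => // [|k]; first exact: T_L_gt0.
  rewrite ler_pdivlMr // => kn.
  have [k2|k3] := leqP k 2.
    have le4mn : (4 * m <= n)%N by rewrite -(ler_nat R) natrM; have := ler0n R n; lra.
    by apply: leq_trans (T_L_ge9 m0 le4mn); rewrite (leq_exp2l _ 2).
  apply: (@T_L_ge_log R) => //; rewrite -/L.
  have {}k3 : 3 <= k%:R :> R by rewrite ler_nat.
  have m1 : 0 < m%:R :> R by rewrite ltr0n.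
  have kL : k%:R * ln 9 < k%:R * (10 * L) by rewrite ltr_pM2l //; lra.
  have mL : m%:R * ln 10 < m%:R * (18 * L) by rewrite ltr_pM2l.
  (* From 3 <= k follows 93 <= 33 k, so 43 k <= n - 18 m + 93 yields 10 k + 18 m <= n. *)
  have nL : (10 * k%:R + 18 * m%:R) * L <= n%:R * L by rewrite ler_pM2r; lra.
  lra.
pose c := 10 * L - ln 9.
have c0 : 0 < c by rewrite subr_gt0.
near=> n.
have mn0 : (0 < m n)%N by apply: m0; near: n; exact: nbhs_infty_gt.
(* The error terms 10 m ln 10 and 21 ln 9 must together stay below c n; each is given half of it. *)
have mn : 20 * ln 10 * (m n)%:R <= c * n%:R.
  have : `|(m n)%:R : R| <= c / (20 * ln 10) * `|n%:R : R|.
    by near: n; apply: mo; rewrite divr_gt0 // mulr_gt0.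
  by rewrite !normr_nat mulrAC ler_pdivlMr ?mulr_gt0 // mulrC.
have nbig : 42 * ln 9 < c * n%:R.
  by rewrite -ltr_pdivrMl //; near: n; exact: nbhs_infty_gtr.
apply: (@expz_floor_le _ _ 3) => // [|k]; first exact: T_L_gt0.
rewrite ler_pdivlMr // => kn; apply: (@T_L_ge_log R) => //; rewrite -/L.
have kL : 10 * k%:R * ln 9 <= (n%:R + 21) * ln 9 :> R.
  by rewrite ler_pM2r //; have := ler0n R (m n); lra.
by rewrite /c in mn nbig; lra.
Unshelve. all: end_near.
Qed.
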